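(* Let $s>0$ and $-1/2<\sigma<0$. There exists $C'''>0$, depending only on $\sigma$ and $s$, such that $\phi_k^2(x)\le C'''$ for all integers $k\ge 0$ and all $x\in\mathbb{R}$ with $|x|\le 1$.
   Context: For $s>0$ and $\sigma>-1/2$, let $p_k$ ($k=0,1,2,\dots$) be the orthonormal polynomials for the measure $e^{-sx^2}|x|^{2\sigma}\,dx$ on $\mathbb{R}$: $p_k$ has degree $k$, positive leading coefficient, and $\int_{-\infty}^{\infty}p_k p_\ell\,|x|^{2\sigma}e^{-sx^2}\,dx=\delta_{k\ell}$. Put $\phi_k(x)=p_k(x)e^{-sx^2/2}$ (generalized Hermite functions). *)

(* Defs.v *)
From mathcomp Require Import all_boot all_order all_algebra.
From mathcomp Require Import all_classical all_reals all_analysis.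
Set Implicit Arguments.
Unset Strict Implicit.
Unset Printing Implicit Defensive.
Import Order.TTheory GRing.Theory Num.Theory.
Import numFieldNormedType.Exports.

Local Open Scope ring_scope.

(* For sigma < 0 the density is +oo at x = 0, where [powR] returns 0 instead:
   this changes it only on a Lebesgue-null set. *)
Definition ghermite_weight (R : realType) (s sigma x : R) : R :=
  `|x| `^ (2 * sigma) * expR (- (s * x ^+ 2)).

(* For s > 0 and sigma > -1/2 these conditions determine [p] uniquely.
   [size] is one more than the degree. The extended integral of a measurable
   function is finite only if the function is integrable, so integrability of
   the products is part of the last condition. *)
Definition ghermite_orthonormal (R : realType) (s sigma : R)
    (p : nat -> {poly R}) : Prop :=
  [/\ forall k, size (p k) = k.+1,
      forall k, 0 < lead_coef (p k) &
      forall k l,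
        (\int[@lebesgue_measure R]_(x in setT)
           ((p k).[x] * (p l).[x] * ghermite_weight s sigma x)%:E)%E
        = (k == l)%:R%:E :> \bar R].

Definition ghermite_fun (R : realType) (s : R) (p : nat -> {poly R})
    (k : nat) (x : R) : R :=
  (p k).[x] * expR (- (s * x ^+ 2) / 2).

(* Main.v *)
(* Let T f = f' + sigma (f(x) - f(-x)) / x be the Dunkl operator. Integration by
   parts against the weight |x|^(2 sigma) exp(-s x^2) makes T adjoint to
   A f = 2 s x f - T f; since T lowers and A raises the degree by one,
   orthogonality gives T p_{k+1} = a p_k and A p_k = a p_{k+1} for the same a.
   With p = p_{k+1}, q = p_k and
   H(x) = p(x)^2 + p(-x)^2 + q(x)^2 + q(-x)^2, these two relations yield
   H'(x) / 2 = 2 s x (q(x)^2 + q(-x)^2)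
     - (sigma / x) ((p(x) - p(-x))^2 + (q(x) - q(-x))^2),
   which is nonnegative for x > 0 because sigma < 0. Hence for |x| <= 1 the value
   p_k(x)^2 <= H(|x|) is at most H on [1, 2], where the weight is bounded below,
   while the integral of H against the weight is 4. *)
Require Import Defs.
From mathcomp Require Import all_boot all_order all_algebra.
From mathcomp Require Import all_classical all_reals all_analysis.
From mathcomp Require Import measurable_realfun ring lra.
Import Order.TTheory GRing.Theory Num.Theory.
Import numFieldNormedType.Exports.
Local Open Scope ring_scope.

(** * The Dunkl operator and its ladder relations *)

Section Dunkl.
Context {R : realFieldType} (s sigma : R).
Implicit Types f g : {poly R}.

Definition refl_poly f : {poly R} := f \Po (- 'X).

(* (f(x) - f(-x)) / x: the numerator has no constant term. *)
Definition odd_quot f : {poly R} := drop_poly 1 (f - refl_poly f).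

Definition dunkl f : {poly R} := f^`() + sigma *: odd_quot f.

Definition dunkl_raise f : {poly R} := (2 * s) *: ('X * f) - dunkl f.

Lemma horner_refl f x : (refl_poly f).[x] = f.[- x].
Proof. by rewrite horner_comp hornerN hornerX. Qed.

Lemma refl_polyD f g : refl_poly (f + g) = refl_poly f + refl_poly g.
Proof. exact: comp_polyD. Qed.

Lemma refl_polyM f g : refl_poly (f * g) = refl_poly f * refl_poly g.
Proof. exact: comp_polyM. Qed.

Lemma refl_polyX : refl_poly 'X = - 'X.
Proof. by rewrite /refl_poly comp_polyX. Qed.

Lemma refl_polyZ a f : refl_poly (a *: f) = a *: refl_poly f.
Proof. exact: comp_polyZ. Qed.

Lemma refl_polyK : involutive refl_poly.
Proof.
by move=> f; rewrite /refl_poly -comp_polyA raddfN/= comp_polyX opprK comp_polyXr.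
Qed.

Lemma size_refl_poly f : size (refl_poly f) = size f.
Proof. by rewrite size_comp_poly2// size_polyN size_polyX. Qed.

Lemma deriv_refl f : (refl_poly f)^`() = - refl_poly f^`().
Proof. by rewrite /refl_poly deriv_comp derivN derivX mulrN1. Qed.

Lemma mulX_odd_quot f : 'X * odd_quot f = f - refl_poly f.
Proof.
rewrite /odd_quot -[RHS](poly_take_drop 1) mulrC expr1 -[LHS]add0r; congr (_ + _).
apply/esym/polyP => -[|i]; rewrite coef_take_poly coef0//=.
by rewrite -horner_coef0 hornerD hornerN horner_refl oppr0 subrr.
Qed.

(** Identities for [odd_quot] are checked after multiplication by ['X], where [mulX_odd_quot]
    removes the quotient. *)
Lemma mulXI : injective (fun f : {poly R} => 'X * f).
Proof. by apply: mulfI; rewrite polyX_eq0. Qed.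

(** A quotient of two odd polynomials, [f - refl_poly f] and ['X], is even. *)
Lemma refl_odd_quot f : refl_poly (odd_quot f) = odd_quot f.
Proof.
apply: mulXI => /=; apply: oppr_inj; rewrite -mulNr -{1}refl_polyX -refl_polyM.
rewrite mulX_odd_quot refl_polyD /refl_poly raddfN/= -!/(refl_poly _) refl_polyK.
by rewrite opprB.
Qed.

Lemma odd_quotM f g : odd_quot (f * g) =
  odd_quot f * g + f * odd_quot g - 'X * odd_quot f * odd_quot g.
Proof.
apply: mulXI => /=; rewrite mulX_odd_quot refl_polyM.
have Rf h : refl_poly h = h - 'X * odd_quot h by rewrite mulX_odd_quot subKr.
rewrite !Rf; ring.
Qed.

Lemma dunklM f g : dunkl (f * g) =
  dunkl f * g + f * dunkl g - sigma *: ('X * odd_quot f * odd_quot g).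
Proof. rewrite /dunkl derivM odd_quotM -!mul_polyC; ring. Qed.

Lemma size_dunkl f : (size (dunkl f) <= (size f).-1)%N.
Proof.
rewrite (leq_trans (size_polyD _ _))// geq_max size_poly andTb.
rewrite (leq_trans (size_scale_leq _ _))// size_drop_poly subn1 -!subn1 leq_sub2r//.
by rewrite (leq_trans (size_polyD _ _))// size_polyN size_refl_poly maxnn.
Qed.

Lemma size_dunkl_raise f : (size (dunkl_raise f) <= (size f).+1)%N.
Proof.
rewrite (leq_trans (size_polyD _ _))// geq_max size_polyN.
rewrite (leq_trans (size_scale_leq _ _))/=; last first.
  by rewrite (leq_trans (size_polyMleq _ _))// size_polyX.
by rewrite (leq_trans (size_dunkl _))// (leq_trans (leq_pred _)).
Qed.

End Dunkl.

(** * Expansion in a sequence with one polynomial of each degree *)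

Lemma size_sub_lead {R : fieldType} (p : nat -> {poly R}) n (f : {poly R}) :
  (forall k, size (p k) = k.+1) -> (size f <= n.+1)%N ->
  exists a, (size (f - a *: p n)%R <= n)%N.
Proof.
move=> sp sf; exists (f`_n / (p n)`_n).
have pn0 : (p n)`_n != 0.
  by have := lead_coef_eq0 (p n); rewrite lead_coefE sp/= -size_poly_eq0 sp => ->.
apply/leq_sizeP => i; rewrite leq_eqVlt => /predU1P[<-|ni].
  by rewrite coefB coefZ divfK// subrr.
rewrite coefB coefZ [(p n)`_i]nth_default ?sp// mulr0 subr0.
exact/nth_default/(leq_trans sf ni).
Qed.

(** Cancelling the top coefficient with [p n] lowers the degree, so [p 0], ..., [p n.-1] span the
    polynomials of size at most [n]. The closure hypothesis is restricted to [k < n], so that it can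
    be met by orthogonality to lower degrees. *)
Lemma poly_span_ind {R : fieldType} (p : nat -> {poly R}) (P : {poly R} -> Prop) :
  (forall k, size (p k) = k.+1) -> P 0 ->
  forall n, (forall k a f, (k < n)%N -> P f -> P (f + a *: p k)) ->
  forall f : {poly R}, (size f <= n)%N -> P f.
Proof.
move=> sp P0; elim=> [|n IHn] PD f sf.
  by move: sf; rewrite leqn0 size_poly_eq0 => /eqP->.
have [a sfa] := size_sub_lead _ _ _ sp sf.
rewrite -(subrK (a *: p n) f); apply: (PD) => //; apply: IHn => // k b g kn.
by apply: PD; rewrite ltnS ltnW.
Qed.

(** * Ladder relations for a functional [L], later integration against the weight *)

Section Ladder.
Context {R : realFieldType} (s sigma : R) (L : {poly R} -> R).
Variable p : nat -> {poly R}.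
Hypothesis L_scalar : scalar L.
Hypothesis L_refl : forall f, L (refl_poly f) = L f.
Hypothesis L_dunkl : forall f, L (dunkl sigma f) = L ((2 * s) *: ('X * f)).
Hypothesis size_p : forall k, size (p k) = k.+1.
Hypothesis p_orthonormal : forall k l, L (p k * p l) = (k == l)%:R.

Let LD f g : L (f + g) = L f + L g.
Proof. by have := L_scalar 1 f g; rewrite scale1r mul1r. Qed.

Let L0 : L 0 = 0.
Proof. by apply: (addrI (L 0)); rewrite -LD !addr0. Qed.

Let LZ a f : L (a *: f) = a * L f.
Proof. by have := L_scalar a f 0; rewrite L0 !addr0. Qed.

Let LB f g : L (f - g) = L f - L g.
Proof. by rewrite LD -scaleN1r LZ mulN1r. Qed.

(* The correction term in the Leibniz rule [dunklM] is odd. *)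
Lemma dunkl_adjoint f g :
  L (dunkl sigma f * g) = L (f * dunkl_raise s sigma g).
Proof.
have odd0 h : refl_poly h = - h -> L h = 0.
  by move=> /(congr1 L); rewrite L_refl -scaleN1r LZ; lra.
have := L_dunkl (f * g); rewrite dunklM LB LD LZ (odd0 ('X * _ * _)); last first.
  by rewrite !refl_polyM !refl_odd_quot refl_polyX !mulNr.
rewrite mulr0 subr0 /dunkl_raise mulrBr LB => /(canRL (addrK _)) ->.
by rewrite -scalerAr mulrCA.
Qed.

Lemma orthogonal_lower k (f : {poly R}) : (size f <= k)%N -> L (f * p k) = 0.
Proof.
move: f; apply: (poly_span_ind p (fun f => L (f * p k) = 0)) => //.
  by rewrite mul0r L0.
move=> j a g jk Lg; rewrite mulrDl LD Lg -scalerAl LZ p_orthonormal.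
by rewrite ltn_eqF// mulr0 addr0.
Qed.

(** Pairing with [p n] shows that the coefficient of [p n] in [f] is 0, so the degree drops and
    induction applies. *)
Lemma orthogonal_eq0 n (f : {poly R}) : (size f <= n)%N ->
  (forall j, (j < n)%N -> L (f * p j) = 0) -> f = 0.
Proof.
elim: n => [|n IHn] in f *; first by rewrite leqn0 size_poly_eq0 => /eqP.
move=> sf Lf; suff sfn : (size f <= n)%N.
  by apply: IHn => // j jn; apply: Lf; rewrite ltnS ltnW.
have [a sg] := size_sub_lead _ _ _ size_p sf.
have : L ((f - a *: p n) * p n) = 0 by apply: orthogonal_lower.
rewrite mulrBl LB -scalerAl LZ p_orthonormal eqxx mulr1 Lf// sub0r => /eqP.
by rewrite oppr_eq0 => /eqP a0; move: sg; rewrite a0 scale0r subr0.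
Qed.

Lemma orthonormal_ladder k : exists a,
  dunkl sigma (p k.+1) = a *: p k /\ dunkl_raise s sigma (p k) = a *: p k.+1.
Proof.
set T := dunkl sigma; set A := dunkl_raise s sigma.
have sT j : (size (T (p j)) <= j)%N by rewrite (leq_trans (size_dunkl _ _))// size_p.
have sA j : (size (A (p j)) <= j.+2)%N.
  by rewrite (leq_trans (size_dunkl_raise _ _ _))// size_p.
(* By adjointness this is also the pairing of [p k.+1] with [A (p k)], which is why one [a] serves
   both relations. *)
exists (L (T (p k.+1) * p k)); set a := L _.
split; apply/eqP; rewrite -subr_eq0; apply/eqP.
  apply: (@orthogonal_eq0 k.+1) => [|j].
    rewrite (leq_trans (size_polyD _ _))// geq_max sT size_polyN.
    by rewrite (leq_trans (size_scale_leq _ _))// size_p.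
  rewrite mulrBl LB -scalerAl LZ p_orthonormal ltnS leq_eqVlt => /predU1P[->|jk].
    by rewrite eqxx mulr1 subrr.
  (* Here [j < k], so [A (p j)] has degree at most [k] and is orthogonal to [p k.+1]. *)
  rewrite gtn_eqF// mulr0 subr0 dunkl_adjoint mulrC orthogonal_lower//.
  exact: leq_trans (sA _) _.
apply: (@orthogonal_eq0 k.+2) => [|j].
  rewrite (leq_trans (size_polyD _ _))// geq_max sA size_polyN.
  by rewrite (leq_trans (size_scale_leq _ _))// size_p.
rewrite mulrBl LB -scalerAl LZ p_orthonormal mulrC -dunkl_adjoint ltnS.
rewrite leq_eqVlt => /predU1P[->|jk].
  by rewrite eqxx mulr1 subrr.
(* Here [j <= k], so [T (p j)] has size at most [k] and is orthogonal to [p k]. *)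
rewrite gtn_eqF// mulr0 subr0 orthogonal_lower//.
exact: leq_trans (sT _) _.
Qed.

End Ladder.

(** * Monotonicity of the energy of two consecutive polynomials *)

Section Energy.
Context {R : realType} (s sigma : R).
Implicit Types p q : {poly R}.

Definition energy p q : {poly R} :=
  p ^+ 2 + refl_poly p ^+ 2 + q ^+ 2 + refl_poly q ^+ 2.

(** The relations express the derivatives of [p] and [q]. The terms in [a] cancel because both
    relations share it, and the even quotients meet [p - refl_poly p = 'X * odd_quot p], and
    likewise for [q], to form squares. *)
Lemma deriv_energy p q a :
  dunkl sigma p = a *: q -> dunkl_raise s sigma q = a *: p ->
  (energy p q)^`() = 2 *: ('X *
    ((2 * s) *: (q ^+ 2 + refl_poly q ^+ 2)
     - sigma *: (odd_quot p ^+ 2 + odd_quot q ^+ 2))).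
Proof.
rewrite /dunkl_raise /dunkl => /(canRL (addrK _)) Ep Eq.
have {}Eq : q^`() = (2 * s) *: ('X * q) - a *: p - sigma *: odd_quot q.
  by rewrite -Eq; ring.
have Rf h : refl_poly h = h - 'X * odd_quot h by rewrite mulX_odd_quot subKr.
have D2 h : (h ^+ 2)^`() = 2%:R *: (h * h^`()) :> {poly R}.
  by rewrite expr2 derivM -mul_polyC; ring.
rewrite /energy !derivD !D2 !deriv_refl Ep Eq.
rewrite /refl_poly !raddfB/= -!/(refl_poly _) !refl_polyZ.
rewrite refl_polyM refl_polyX !refl_odd_quot !Rf -!mul_polyC; ring.
Qed.

Lemma energy_homo p q a (s_ge0 : 0 <= s) (sigma_le0 : sigma <= 0) :
  dunkl sigma p = a *: q -> dunkl_raise s sigma q = a *: p ->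
  forall x y, 0 <= x -> x <= y -> (energy p q).[x] <= (energy p q).[y].
Proof.
move=> Tp Aq; apply: ger0_derive1_ndecry => [x _|x|].
- exact: derivable_horner.
- rewrite in_itv/= andbT => x0; rewrite -derivE (deriv_energy _ _ _ Tp Aq).
  rewrite hornerZ hornerM hornerX hornerD hornerN !hornerZ !hornerD !horner_exp.
  rewrite !mulr_ge0 ?(ltW x0)// subr_ge0 (@le_trans _ _ 0)//.
    by rewrite mulr_le0_ge0// addr_ge0// sqr_ge0.
  by rewrite !mulr_ge0// addr_ge0// sqr_ge0.
- exact/continuous_subspaceT/continuous_horner.
Qed.

Lemma horner_energy p q x :
  (energy p q).[x] = p.[x] ^+ 2 + p.[- x] ^+ 2 + q.[x] ^+ 2 + q.[- x] ^+ 2.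
Proof. by rewrite !hornerD !horner_exp !horner_refl. Qed.

Lemma energyN p q x : (energy p q).[- x] = (energy p q).[x].
Proof. by rewrite !horner_energy opprK; ring. Qed.

Lemma energy_ge p q x : q.[x] ^+ 2 <= (energy p q).[x].
Proof.
have := (sqr_ge0 p.[x], sqr_ge0 p.[-x], sqr_ge0 q.[-x]).
by rewrite horner_energy => -[[? ?] ?]; lra.
Qed.

End Energy.

Local Open Scope classical_set_scope.

(** * Integration by parts against the weight *)

(** The integral is the difference of those of the positive and negative parts. It is finite only if
    both are, and their sum is the integral of the absolute value. *)
Lemma fin_num_integrable {d : measure_display} {T : measurableType d} {R : realType}
    (mu : {measure set T -> \bar R}) (D : set T) (f : T -> \bar R) :
  measurable D -> measurable_fun D f ->
  (\int[mu]_(x in D) f x)%E \is a fin_num -> mu.-integrable D f.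
Proof.
move=> mD mf; rewrite integralE fin_numB => /andP[fp fn].
apply/integrableP; split => //.
rewrite (eq_integral (f^\+ \+ f^\-)%E) => [|x _]; last first.
  by have := congr1 (@^~ x) (fune_abse f).
rewrite ge0_integralD//; first by rewrite ltey_eq fin_numD fp fn.
- exact: measurable_funepos.
- exact: measurable_funeneg.
Qed.

Lemma cvg_exp_expRN {R : realType} (c : R) n : 0 < c ->
  x ^+ n * expR (- (c * x)) @[x --> +oo] --> 0.
Proof.
(* Since exp(cx) >= (cx)^(n+1) / (n+1)!, the function is at most K / x. *)
move=> c0; set K : R := n.+1`!%:R / c ^+ n.+1.
apply: (@squeeze_cvgr _ _ _ _ (cst 0) (fun x => K * x^-1)).
- near=> x; have x0 : 0 < x by [].
  rewrite mulr_ge0 ?exprn_ge0 ?expR_ge0 ?(ltW x0)//= expRN.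
  rewrite ler_pdivrMr ?expR_gt0// mulrAC ler_pdivlMr// -exprSr -ler_pdivrMl.
    rewrite (le_trans _ (expR_ge1Dxn n (ltW (mulr_gt0 c0 x0))))//.
    by rewrite invf_div exprMn mulrAC lerDr.
  by rewrite divr_gt0 ?exprn_gt0// ltr0n fact_gt0.
- exact: cvg_cst.
- rewrite -[X in _ --> X](mulr0 K); apply: cvgMl_tmp.
  by apply/gtr0_cvgV0; [exact: nbhs_pinfty_gt|exact: cvg_id].
Unshelve. all: by end_near. Qed.

Lemma cvg_horner_expRN {R : realType} (c : R) (g : {poly R}) : 0 < c ->
  g.[x] * expR (- (c * x)) @[x --> +oo] --> 0.
Proof.
(* The extra power of [x] absorbs the factor ['X] in the induction on [g * 'X + a%:P]. *)
move=> c0; suff H n : x ^+ n * g.[x] * expR (- (c * x)) @[x --> +oo] --> 0.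
  by have := H 0; under eq_cvg do rewrite expr0 mul1r.
elim/poly_ind: g n => [|g a IH] n.
  by under eq_cvg do rewrite horner0 mulr0 mul0r; exact: cvg_cst.
have -> : (fun x => x ^+ n * (g * 'X + a%:P).[x] * expR (- (c * x))) =
   (fun x => x ^+ n.+1 * g.[x] * expR (- (c * x)) + a * (x ^+ n * expR (- (c * x)))).
  by apply/funext => x; rewrite hornerMXaddC exprS; ring.
rewrite -[X in _ --> X]addr0 -[X in _ --> _ + X](mulr0 a).
by apply: cvgD => //; apply: cvgMl_tmp; exact: cvg_exp_expRN.
Qed.

(** Lebesgue measure is its own pushforward under negation. *)
Lemma Rintegral_opp {R : realType} (f : R -> R) :
  measurable_fun [set: R] f -> lebesgue_measure.-integrable setT (EFin \o f) ->
  \int[@lebesgue_measure R]_x f (- x) = \int[@lebesgue_measure R]_x f x.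
Proof.
move=> mf intf; rewrite /Rintegral; congr fine.
have mN : measurable_fun setT (-%R : measurableTypeR R -> measurableTypeR R).
  exact: oppr_measurable.
transitivity (\int[pushforward lebesgue_measure
    (-%R : measurableTypeR R -> measurableTypeR R)]_x (f (- x)%R)%:E)%E.
  by apply: eq_measure_integral => //= A mA _; exact/esym/lebesgue_measureN.
rewrite integral_pushforward//=.
- by apply: eq_integral => x _; rewrite opprK.
- by apply/measurable_EFinP; exact: measurableT_comp.
- by apply: eq_integrable intf => // x _; rewrite /= opprK.
Qed.

(** Dominated convergence with majorant |f|. The compact intervals exhaust the half-line while
    avoiding the singular point 0; the right end [n.+2] keeps them nondegenerate already at
    [n = 0]. *)
Lemma cvg_integral_itv0y {R : realType} (f : R -> \bar R) :
  (forall x, f x \is a fin_num) -> lebesgue_measure.-integrable `]0, +oo[ f ->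
  (\int[@lebesgue_measure R]_(x in `[n.+1%:R^-1%R, n.+2%:R%R]) f x)%E @[n --> \oo] -->
  (\int[@lebesgue_measure R]_(x in `]0%R, +oo[) f x)%E.
Proof.
move=> ff intf.
have S n : `[n.+1%:R^-1, n.+2%:R] = `]0, +oo[ `&` `[n.+1%:R^-1, n.+2%:R] :> set R.
  rewrite setIidr// => x; rewrite /= !in_itv/= andbT => /andP[+ _].
  by apply: lt_le_trans; rewrite invr_gt0.
have -> : (fun n => \int[@lebesgue_measure R]_(x in `[n.+1%:R^-1%R, n.+2%:R%R])
    f x)%E = (fun n => \int[@lebesgue_measure R]_(x in `]0%R, +oo[)
    (f \_ `[n.+1%:R^-1%R, n.+2%:R%R]) x)%E.
  by apply/funext => n; rewrite S integral_mkcondr -S.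
apply: (@dominated_cvg _ _ R lebesgue_measure `]0, +oo[ _
  (fun n : nat => f \_ `[n.+1%:R^-1, n.+2%:R]) f (abse \o f)) => //=.
- move=> n; apply/(measurable_restrict f) => //.
  by apply: measurable_funS (measurable_int _ intf) => //; exact: subIsetl.
- move=> x; rewrite in_itv/= andbT => x0.
  apply: cvg_near_cst; near=> n.
  rewrite patchE mem_set//= in_itv/=; apply/andP; split.
    by apply: ltW; near: n; exact: (near_infty_natSinv_lt (PosNum x0)).
  apply: (@le_trans _ _ n%:R); last by rewrite ler_nat -addn2 leq_addr.
  by near: n; exact: nbhs_infty_ger.
- by move=> x _; rewrite abse_fin_num.
- by apply: integrable_abse.
- by move=> n x _; rewrite patchE; case: ifPn => //= _; rewrite normr0 abse_ge0.
Unshelve. all: by end_near. Qed.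

Section Weight.
Context {R : realType} (s sigma : R).
Local Notation w := (ghermite_weight s sigma).
Local Notation mu := (@lebesgue_measure R).

Lemma ghermite_weight_ge0 x : 0 <= w x.
Proof. by rewrite mulr_ge0 ?powR_ge0 ?expR_ge0. Qed.

Lemma ghermite_weightN x : w (- x) = w x.
Proof. by rewrite /ghermite_weight normrN sqrrN. Qed.

(* [powR] returns 0 at the base 0, so no correction at the origin is needed when
   an integral is split by sign. *)
Lemma ghermite_weight0 : sigma < 0 -> w 0 = 0.
Proof.
move=> s0; rewrite /ghermite_weight normr0 powR0 ?mul0r//.
by rewrite mulf_neq0 ?pnatr_eq0// lt_eqF.
Qed.

Lemma measurable_ghermite (f : {poly R}) :
  measurable_fun [set: R] (fun x => f.[x] * w x).
Proof.
apply: measurable_funM.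
  by apply: continuous_measurable_fun; exact: continuous_horner.
apply: measurable_funM.
  exact: (measurableT_comp (@measurable_powR R (2 * sigma)) (@normr_measurable R setT)).
have me : measurable_fun [set: R] (fun x : R => - (s * x ^+ 2)).
  apply: (measurableT_comp (@oppr_measurable R setT)).
  by apply: measurable_funM => //; exact: exprn_measurable.
exact: (measurableT_comp (@measurable_expR R) me).
Qed.

(** The polynomial factor left when the derivative of x d(x) w(x), for x > 0, is divided by w(x). *)
Definition ghermite_deriv (d : {poly R}) : {poly R} :=
  'X * d^`() + (1 + 2 * sigma) *: d - (2 * s) *: ('X ^+ 2 * d).

(** For x > 0 this is x d(x) w(x). Merging x with the power gives the exponent 1 + 2 sigma, positive
    when sigma > -1/2, hence the limit 0 at the origin. *)
Definition ghermite_prim (d : {poly R}) (x : R) : R :=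
  d.[x] * x `^ (1 + 2 * sigma) * expR (- (s * x ^+ 2)).

Lemma is_derive_ghermite_prim (d : {poly R}) (x : R) : 0 < x ->
  is_derive x 1 (ghermite_prim d) ((ghermite_deriv d).[x] * w x).
Proof.
move=> x0.
have Dd : is_derive x 1 (horner d) (d^`().[x]).
  by apply: DeriveDef; [exact: derivable_horner|rewrite -derive1E -derivE].
have De : is_derive x 1 (fun y => expR (- (s * y ^+ 2)))
    (- (2 * s * x) * expR (- (s * x ^+ 2))).
  apply: is_derive_eq.
  rewrite /GRing.scale/=; ring.
have Dp := @is_derive1_powR R (1 + 2 * sigma) x x0.
apply: (is_derive_eq (is_deriveM (is_deriveM Dd Dp) De)).
rewrite /GRing.scale/= fctE /ghermite_weight gtr0_norm//.
rewrite (_ : _ - 1 = 2 * sigma); last by ring.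
rewrite powRD ?(gt_eqF x0) ?implybT// powRr1 ?(ltW x0)//.
rewrite /ghermite_deriv !(hornerD, hornerN, hornerZ, hornerM, hornerX, horner_exp).
ring.
Qed.

Lemma ghermite_prim_cvg0 (d : {poly R}) : 0 < 1 + 2 * sigma ->
  ghermite_prim d x @[x --> 0^'+] --> 0.
Proof.
move=> a0.
have Ce : continuous (fun x : R => expR (- (s * x ^+ 2))).
  move=> x; apply: continuous_comp; last exact: continuous_expR.
  by apply: continuousN; apply: cvgMl_tmp; exact: exprn_continuous.
rewrite [X in _ --> X](_ : _ = d.[0] * 0 * expR (- (s * 0 ^+ 2))); last by ring.
apply: cvgM; last exact: cvg_at_right_filter (Ce 0).
apply: cvgM; last exact: powR_cvg0.
by apply: cvg_at_right_filter; exact: continuous_horner.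
Qed.

(** For x >= 1, x^(1 + 2 sigma) <= x because sigma < 0, and exp(-s x^2) <= exp(-s x), which reduces
    the claim to a polynomial times exp(-s x). *)
Lemma ghermite_prim_cvgy (d : {poly R}) : 0 < s -> sigma < 0 ->
  ghermite_prim d x @[x --> +oo] --> 0.
Proof.
move=> s0 sg0; have := cvg_horner_expRN _ ('X * d) s0.
move=> /cvg_norm; rewrite normr0 => H; apply: norm_cvg0.
apply: (@squeeze_cvgr _ _ _ _ (cst 0)
  (fun x => `|('X * d).[x] * expR (- (s * x))|)); [|exact: cvg_cst|exact: H].
near=> x; have x1 : 1 <= x by [].
have x0 : 0 <= x by apply: le_trans x1.
rewrite normr_ge0/= !normrM hornerM hornerX normrM [`|x| * _]mulrC.
apply: ler_pM; rewrite ?mulr_ge0//.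
  apply: ler_wpM2l => //; rewrite !ger0_norm ?powR_ge0//.
  by rewrite -[leRHS]powRr1// ler_powR// gerDl; lra.
rewrite !ger0_norm ?expR_ge0// ler_expR lerN2 ler_pM2l// expr2.
by rewrite ler_peMr.
Unshelve. all: by end_near. Qed.

Lemma continuous_ghermite (f : {poly R}) (x : R) : 0 < x ->
  {for x, continuous (fun x => f.[x] * w x)}.
Proof.
move=> x0; apply: cvgM; first exact: continuous_horner.
apply: cvgM.
  have Cp : {for `|x|, continuous (fun y : R => y `^ (2 * sigma))}.
    rewrite gtr0_norm//; apply/differentiable_continuous/derivable1_diffP.
    by case: (@is_derive1_powR R (2 * sigma) x x0).
  apply: (@cvg_comp _ _ _ (fun y : R => `|y|) (fun y => y `^ (2 * sigma)) _ _ _ _ Cp).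
  exact: norm_continuous.
apply: continuous_comp; last exact: continuous_expR.
by apply: continuousN; apply: cvgMl_tmp; exact: exprn_continuous.
Qed.

(** The fundamental theorem of calculus applies on each compact interval, and the boundary values of
    [ghermite_prim d] vanish in the limit at both ends. *)
Lemma integral_ghermite_deriv0y (d : {poly R}) :
  0 < s -> 0 < 1 + 2 * sigma -> sigma < 0 ->
  mu.-integrable `]0, +oo[ (fun x => ((ghermite_deriv d).[x] * w x)%:E) ->
  (\int[mu]_(x in `]0%R, +oo[) ((ghermite_deriv d).[x] * w x)%:E = 0)%E.
Proof.
move=> s0 a0 sg0 intd.
have := cvg_integral_itv0y _ _ intd => /(_ (fun=> erefl)) H.
have ltab n : n.+1%:R^-1 < n.+2%:R :> R.
  by rewrite (@le_lt_trans _ _ 1) ?invf_le1 ?ler1n ?ltr1n.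
have ab0 n x : n.+1%:R^-1 <= x -> 0 < x :> R by apply: lt_le_trans; rewrite invr_gt0.
have E n : (\int[mu]_(x in `[n.+1%:R^-1%R, n.+2%:R%R]) ((ghermite_deriv d).[x] * w x)%:E
   = (ghermite_prim d n.+2%:R - ghermite_prim d n.+1%:R^-1)%:E)%E.
  have Dp (x : R) : n.+1%:R^-1 <= x -> 
      is_derive x 1 (ghermite_prim d) ((ghermite_deriv d).[x] * w x).
    by move=> /ab0; exact: is_derive_ghermite_prim.
  have Cp (x : R) : n.+1%:R^-1 <= x -> {for x, continuous (ghermite_prim d)}.
    move=> /Dp [? _]; exact/differentiable_continuous/derivable1_diffP.
  rewrite (@continuous_FTC2 _ _ (ghermite_prim d)) ?EFinB//.
  - apply: continuous_in_subspaceT => x; rewrite inE/= in_itv/= => /andP[/ab0 x0 _].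
    exact: continuous_ghermite.
  - split => [x||].
    + by rewrite in_itv/= => /andP[/ltW/Dp[]].
    + exact/cvg_at_right_filter/Cp.
    + exact/cvg_at_left_filter/Cp/ltW.
  - by move=> x; rewrite in_itv/= => /andP[/ltW/Dp[_ <-] _]; rewrite derive1E.
rewrite -(cvg_lim _ H)//; apply/cvg_lim => //.
under eq_cvg do rewrite E.
apply: cvg_EFin; first exact: nearW.
rewrite -[X in _ --> X](subrr 0); apply: cvgB.
  apply: (cvg_pinftyP _ _).1 (ghermite_prim_cvgy d s0 sg0) _ _.
  have := @cvgr_idn R; rewrite -(cvg_shiftn 2) => H2.
  by under eq_fun do rewrite -addn2.
apply: (cvg_at_rightP _ _ _).1 (ghermite_prim_cvg0 d a0) _ _; split.
  by move=> n; rewrite invr_gt0.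
exact: cvg_harmonic.
Qed.
End Weight.

(** * The integral against the weight as a functional on polynomials *)

Section Functional.
Context {R : realType} (s sigma : R).
Local Notation w := (ghermite_weight s sigma).
Local Notation mu := (@lebesgue_measure R).

Definition ghermite_int (f : {poly R}) : R := \int[mu]_x (f.[x] * w x).

Definition ghermite_integrable (f : {poly R}) : Prop :=
  mu.-integrable setT (fun x => (f.[x] * w x)%:E).

(* The products [p k * p 0] are integrable and span all polynomials, so no direct
   estimate of the moments is needed. *)
Lemma orthonormal_integrable (p : nat -> {poly R}) (f : {poly R}) :
  ghermite_orthonormal s sigma p -> ghermite_integrable f.
Proof.
move=> [sp _ op].
have intp k l : ghermite_integrable (p k * p l).
  apply: fin_num_integrable => //.
    by apply/measurable_EFinP; exact: measurable_ghermite.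
  by under eq_integral do rewrite hornerM; rewrite op.
have [c c0 Ep0] : exists2 c, c != 0 & p 0%N = c%:P.
  by apply/size_poly1P; rewrite sp.
suff : ghermite_integrable (f * p 0%N).
  rewrite Ep0 => /(integrableZl measurableT c^-1); apply: eq_integrable => // x _.
  by rewrite -EFinM hornerM hornerC; congr EFin; field.
apply: (poly_span_ind p (fun g => ghermite_integrable (g * p 0%N)) sp _ (size f)) => //.
  apply: (eq_integrable measurableT _ _ _ (integrable0 mu setT)) => x _.
  by rewrite mul0r horner0 mul0r.
move=> k a g _ intg.
apply: (eq_integrable measurableT _ _ _ (integrableD measurableT intg
  (integrableZl measurableT a (intp k 0%N)))) => x _.
by rewrite mulrDl -scalerAl hornerD hornerZ -EFinM -EFinD; congr EFin; ring.
Qed.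

Hypothesis integrable_poly : forall f, ghermite_integrable f.

Lemma ghermite_int_scalar : scalar ghermite_int.
Proof.
move=> a f g; rewrite /ghermite_int -RintegralZl//; last exact: integrable_poly.
rewrite -RintegralD//.
- by apply: eq_Rintegral => x _; rewrite hornerD hornerZ; ring.
- exact: (integrableZl measurableT a (integrable_poly f)).
- exact: integrable_poly.
Qed.

Lemma ghermite_int_refl f : ghermite_int (refl_poly f) = ghermite_int f.
Proof.
rewrite -[RHS](Rintegral_opp _ (measurable_ghermite s sigma f) (integrable_poly f)).
by apply: eq_Rintegral => x _; rewrite horner_refl ghermite_weightN.
Qed.

(** By evenness the integral is twice that over the positive half-line, where the integrand is an
    exact derivative. *)
Lemma ghermite_int_even_deriv d : 0 < s -> 0 < 1 + 2 * sigma -> sigma < 0 ->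
  refl_poly (ghermite_deriv s sigma d) = ghermite_deriv s sigma d ->
  ghermite_int (ghermite_deriv s sigma d) = 0.
Proof.
move=> s0 a0 sg0 even_d; set k := ghermite_deriv s sigma d.
pose g := (fun x => k.[x] * w x) \_ `]0, +oo[.
have mpos : measurable (`]0%R, +oo[ : set (measurableTypeR R)) by [].
have intg : mu.-integrable setT (EFin \o g).
  rewrite -restrict_EFin; apply/integrable_restrict => //=; rewrite setTI.
  exact: integrableS (integrable_poly k).
have mg : measurable_fun setT g.
  by apply/measurable_EFinP; exact: measurable_int intg.
(* At [x = 0] both sides are 0, by [ghermite_weight0]. *)
have kg x : k.[x] * w x = g x + g (- x).
  rewrite /g !patchE !mem_setE !in_itv/= !andbT oppr_gt0 ghermite_weightN.
  rewrite -[k.[- x]]horner_refl even_d.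
  by case: ltgtP => [||<-]; rewrite ?addr0 ?add0r// ghermite_weight0// mulr0.
have intgN : mu.-integrable setT (EFin \o (fun x => g (- x))).
  apply: (eq_integrable measurableT _ _ _
    (integrableB measurableT (integrable_poly k) intg)).
  by move=> x _; rewrite /= -EFinB kg addrAC subrr add0r.
rewrite /ghermite_int (@eq_Rintegral _ _ _ mu setT (fun x => g x + g (- x)));
  last by move=> x _; rewrite kg.
rewrite RintegralD// Rintegral_opp//.
suff -> : \int[mu]_x g x = 0 by rewrite addr0.
rewrite -Rintegral_mkcond /Rintegral integral_ghermite_deriv0y//.
exact: integrableS (integrable_poly k).
Qed.

(** The difference [h] of the two arguments has the same integral as its reflection, and
    [h + refl_poly h] is the exact derivative attached to [odd_quot f]; so twice the integral of [h]
    is 0. *)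
Lemma ghermite_int_dunkl f : 0 < s -> 0 < 1 + 2 * sigma -> sigma < 0 ->
  ghermite_int (dunkl sigma f) = ghermite_int ((2 * s) *: ('X * f)).
Proof.
move=> s0 a0 sg0; set h := dunkl sigma f - (2 * s) *: ('X * f).
have LD a b : ghermite_int (a + b) = ghermite_int a + ghermite_int b.
  by have := ghermite_int_scalar 1 a b; rewrite scale1r mul1r.
have hE : h + refl_poly h = ghermite_deriv s sigma (odd_quot f).
  have rd : refl_poly f^`() = - (f - 'X * odd_quot f)^`().
    by rewrite mulX_odd_quot subKr deriv_refl opprK.
  have rf : refl_poly f = f - 'X * odd_quot f by rewrite mulX_odd_quot subKr.
  rewrite /h /dunkl /ghermite_deriv /refl_poly raddfB raddfD/= -!/(refl_poly _).
  rewrite !refl_polyZ refl_polyM refl_polyX refl_odd_quot rd rf.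
  rewrite derivB derivM derivX -!mul_polyC; ring.
have : ghermite_int (h + refl_poly h) = 0.
  rewrite hE ghermite_int_even_deriv// -hE refl_polyD refl_polyK addrC//.
rewrite LD ghermite_int_refl => h0.
rewrite -[dunkl _ _](subrK ((2 * s) *: ('X * f))) LD -/h; lra.
Qed.

End Functional.

(** * The uniform bound on [-1, 1] *)

(** Both factors of the weight decrease on [1, 2], so the bound is the value at 2. *)
Lemma ghermite_weight_lb {R : realType} (s sigma x : R) :
  0 < s -> sigma < 0 -> 1 <= x <= 2 ->
  2 `^ (2 * sigma) * expR (- (s * 4)) <= ghermite_weight s sigma x.
Proof.
move=> s0 sg0 /andP[x1 x2]; have x0 : 0 < x by apply: lt_le_trans x1.
apply: ler_pM; rewrite ?powR_ge0 ?expR_ge0// ?gtr0_norm//.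
  rewrite -[2 * sigma]opprK !(powRN _ (- (2 * sigma))) lef_pV2 ?posrE ?powR_gt0//.
  by apply: ge0_ler_powR; rewrite ?nnegrE ?(ltW x0)//; lra.
rewrite ler_expR lerN2 ler_pM2l//; nra.
Qed.

Lemma ghermite_sqr_le {R : realType} (s sigma : R) (p : nat -> {poly R}) :
  0 < s -> 0 < 1 + 2 * sigma -> sigma < 0 -> ghermite_orthonormal s sigma p ->
  forall k (x : R), `|x| <= 1 ->
  (p k).[x] ^+ 2 <= 4 / (2 `^ (2 * sigma) * expR (- (s * 4))).
Proof.
move=> s0 a0 sg0 op k x x1; set c := 2 `^ _ * _.
have c0 : 0 < c by rewrite mulr_gt0 ?powR_gt0 ?expR_gt0.
have intp f := orthonormal_integrable s sigma p f op.
have [sp _ oE] := op.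
set L := ghermite_int s sigma.
have Lop i j : L (p i * p j) = (i == j)%:R.
  rewrite /L /ghermite_int /Rintegral.
  by under eq_integral do rewrite hornerM; rewrite oE.
have Lscal : scalar L by exact: ghermite_int_scalar.
have Lrefl f : L (refl_poly f) = L f by exact: ghermite_int_refl.
have LD f g : L (f + g) = L f + L g.
  by have := Lscal 1 f g; rewrite scale1r mul1r.
have [a [Tp Aq]] := orthonormal_ladder s sigma L p Lscal Lrefl
  (fun f => ghermite_int_dunkl s sigma intp f s0 a0 sg0) sp Lop k.
(* Taking [p k] as the lower member of the pair covers [k = 0] as well. *)
set H := energy (p k.+1) (p k).
(* Each of the four squares has integral 1, the reflected ones by evenness of the weight. *)
have LH : L H = 4.
  by rewrite /H /energy !expr2 !LD -!refl_polyM !Lrefl !Lop !eqxx /=; ring.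
have leH t : 1 <= t -> (p k).[x] ^+ 2 <= H.[t].
  move=> t1; apply: (le_trans (energy_ge (p k.+1) _ _)).
  have -> : (energy (p k.+1) (p k)).[x] = H.[`|x|].
    by rewrite /H; case: ger0P => // _; rewrite energyN.
  apply: (energy_homo s sigma _ _ _ _ _ Tp Aq) => //; [exact: ltW|exact: ltW|].
  exact: le_trans t1.
have mu12 : lebesgue_measure (`[1, 2] : set R) = 1%:E.
  by rewrite lebesgue_measure_itv/= lte_fin ltr1n -EFinB (_ : 2 - 1 = 1)//; ring.
rewrite ler_pdivlMr// -LH /L /ghermite_int.
(* As [1, 2] has length 1, the constant equals its integral there. It is then compared with [H]
   times the weight, which is nonnegative off [1, 2]. *)
have -> : (p k).[x] ^+ 2 * c =
    \int[@lebesgue_measure R]_(t in (`[1%R, 2%R] : set R))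
      cst ((p k).[x] ^+ 2 * c) t.
  by rewrite Rintegral_cst//= mu12 mulr1.
rewrite Rintegral_mkcond; apply: le_Rintegral => //.
- rewrite -restrict_EFin; apply/integrable_restrict => //; rewrite setTI.
  apply: measurable_bounded_integrable => //.
    by rewrite [ltLHS]mu12 ltry.
  exact: bounded_cst.
- exact: intp.
- move=> t _; rewrite patchE; case: ifPn => [|_].
    rewrite mem_setE in_itv/= => t12; apply: ler_pM; rewrite ?sqr_ge0 ?(ltW c0)//.
      by apply: leH; case/andP: t12.
    exact: ghermite_weight_lb.
  rewrite mulr_ge0 ?ghermite_weight_ge0//.
  exact: le_trans (sqr_ge0 _) (energy_ge _ _ _).
Qed.

Theorem theorem1p2 (R : realType) (s sigma : R)
    (s_gt0 : 0 < s) (sigma_gt : - (1 / 2) < sigma) (sigma_lt0 : sigma < 0) :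
  exists C : R, 0 < C /\
    forall p : nat -> {poly R}, ghermite_orthonormal s sigma p ->
    forall (k : nat) (x : R), `|x| <= 1 -> ghermite_fun s p k x ^+ 2 <= C.
Proof.
(* This is the bound for the squared polynomials; the squared Gaussian factor of [ghermite_fun] is
   at most 1. *)
exists (4 / (2 `^ (2 * sigma) * expR (- (s * 4)))).
split=> [|p op k x x1]; first by rewrite divr_gt0 ?mulr_gt0 ?powR_gt0 ?expR_gt0.
apply: le_trans (ghermite_sqr_le s sigma p s_gt0 _ sigma_lt0 op k x x1); last by lra.
rewrite /ghermite_fun exprMn ler_piMr ?sqr_ge0// expr_le1 ?expR_ge0//.
rewrite expR_le1 mulNr oppr_le0 divr_ge0// mulr_ge0 ?sqr_ge0//; exact: ltW.
Qed.
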